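(* Let $n,m\ge 1$ and $s\in(0,n)$ be integers and let $f\colon\mathbb{R}^n\to\mathbb{R}$ be of class $C^1$. Assume that $\phi(x)=Ax+b$ is an affine mapping, where $A\in\mathbb{R}^{m\times n}$ and $b\in\mathbb{R}^m$, that $D\subset\mathbb{R}^m$ is a closed convex cone which is a polyhedral convex set, that $0\neq\bar x\in\Omega:=\{x\in\mathbb{R}^n:\phi(x)\in D,\ \|x\|_0\le s\}$ is a local optimal solution of the problem of minimizing $f$ over $\Omega$, and that $f$ is of class $C^{1,1}$ around $\bar x$. If the RRCQ holds at $\bar x$, then for each $u\in T_\Omega(\bar x)\cap\ker\nabla f(\bar x)$ and each $\bar\lambda\in\Lambda^C(\bar x)$ there exists $z\in\partial^2L(\bar x,\bar\lambda)(u)$ such that $\langle z,u\rangle\ge0$.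
   Context: Notation: $\|x\|_0$ is the number of nonzero components of $x$; $\mathcal{S}=\{x\in\mathbb{R}^n:\|x\|_0\le s\}$; $\bar J=\{i:\bar x_i\neq 0\}$; for $J\subset\{1,\dots,n\}$, $\mathbb{R}^n_J=\mathrm{span}\{e_i:i\in J\}$ with $e_i$ the $i$-th unit vector; $\ker\nabla f(\bar x)=\{u:\langle\nabla f(\bar x),u\rangle=0\}$; $\nabla\phi(\bar x)$ is the Jacobian of $\phi$ at $\bar x$ (here equal to $A$). $\bar x\in\Omega$ is a local optimal solution if there is a neighborhood $U$ of $\bar x$ with $f(x)\ge f(\bar x)$ for all $x\in\Omega\cap U$. A real function is of class $C^{1,1}$ around $\bar x$ if on some open neighborhood of $\bar x$ it is Fréchet differentiable with locally Lipschitz gradient. The restricted Robinson constraint qualification (RRCQ) holds at $\bar x$ if $0\in\mathrm{int}\{\phi(\bar x)+\nabla\phi(\bar x)\mathbb{R}^n_{\bar J}-D\}$. For $X\subset\mathbb{R}^n$ and $\bar x\in X$, the contingent cone is $T_X(\bar x)=\{u:\exists t_k\to0^+,\ \exists u_k\to u,\ \bar x+t_ku_k\in X\ \forall k\}$. The Fréchet normal cone is $\widehat N_X(\bar x)=\{v:\limsup_{x\to\bar x,\,x\in X}\langle v,x-\bar x\rangle/\|x-\bar x\|\le0\}$; the limiting normal cone $N_X(\bar x)$ is the set of all limits of sequences $v_k\in\widehat N_X(x_k)$ with $x_k\to\bar x$, $x_k\in X$; the Clarke normal cone is $N^C_X(\bar x)=\mathrm{cl}\,\mathrm{co}\,N_X(\bar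 x)$. For convex $X$, $N_X$ is the normal cone of convex analysis. Lagrangian and multipliers: $L(x,\lambda)=f(x)+\langle\lambda,\phi(x)\rangle$; $\Lambda^C(\bar x)=\{\lambda\in\mathbb{R}^m_+:-\nabla_xL(\bar x,\lambda)\in N^C_{\mathcal S}(\bar x),\ \lambda\in N_D(\phi(\bar x))\}$. For $\psi$ of class $C^{1,1}$ around $\bar x$, the limiting (Mordukhovich) second-order subdifferential is $\partial^2\psi(\bar x)(u)=\{w\in\mathbb{R}^n:(w,-u)\in N_{\mathrm{gph}\,\nabla\psi}(\bar x,\nabla\psi(\bar x))\}$, which equals $\partial\langle u,\nabla\psi\rangle(\bar x)$, where $\partial\varphi(\bar x)=\{v:(v,-1)\in N_{\mathrm{epi}\,\varphi}(\bar x,\varphi(\bar x))\}$ is the limiting subdifferential. $\partial^2L(\bar x,\bar\lambda)(u)$ means $\partial^2\psi(\bar x)(u)$ for $\psi=L(\cdot,\bar\lambda)$. *)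

(* Defs.v *)
From HB Require Import structures.
From mathcomp Require Import all_boot all_order all_algebra.
From mathcomp Require Import all_classical all_reals all_analysis.

Set Implicit Arguments.
Unset Strict Implicit.
Unset Printing Implicit Defensive.

Import Order.TTheory GRing.Theory Num.Theory.
Import numFieldNormedType.Exports.

Local Open Scope classical_set_scope.
Local Open Scope ring_scope.

(* Vectors of R^n are columns 'cV[R]_n.  The library norm `|x| on them is the
   sup norm; it is used for topological notions only (limits, interior,
   differentiability, local Lipschitz continuity), where the choice of norm is
   immaterial.  The Euclidean structure is given by [dot] and [enorm]. *)

Section Euclidean.
Context {R : realType} {n : nat}.
Implicit Types (x y : 'cV[R]_n) (J : {set 'I_n}).

Definition dot x y : R := \sum_(i < n) x i 0 * y i 0.

Definition enorm x : R := Num.sqrt (dot x x).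

Definition supp x : {set 'I_n} := [set i | x i 0 != 0]%SET.

Definition l0norm x : nat := #|supp x|.

Definition sparse_set (s : nat) : set 'cV[R]_n := [set x | (l0norm x <= s)%N].

Definition coord_subspace J : {vspace 'cV[R]_n} :=
  <<[seq (delta_mx i 0 : 'cV[R]_n)%R | i <- enum J]>>%VS.

End Euclidean.

Section Cones.
Context {R : realType} {n : nat}.
Implicit Types (X : set 'cV[R]_n) (x u v : 'cV[R]_n).

Definition contingent_cone X x : set 'cV[R]_n :=
  [set u | exists (t_ : nat -> R) (u_ : nat -> 'cV[R]_n),
    [/\ forall k, 0 < t_ k, t_ @ \oo --> 0, u_ @ \oo --> u &
        forall k, X (x + t_ k *: u_ k)]].

(* If x is isolated in X then the filter is improper, the limsup is -oo and
   every v is a normal. *)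
Definition frechet_normal X x : set 'cV[R]_n :=
  [set v | (limf_esup (fun y : 'cV[R]_n => (dot v (y - x) / enorm (y - x))%:E)
                      (within X x^') <= 0)%E].

Definition limiting_normal X x : set 'cV[R]_n :=
  [set v | exists (x_ v_ : nat -> 'cV[R]_n),
    [/\ forall k, X (x_ k), x_ @ \oo --> x,
        forall k, frechet_normal X (x_ k) (v_ k) & v_ @ \oo --> v]].

Definition convex_hull X : set 'cV[R]_n := smallest (@convex_set R 'cV[R]_n) X.

Definition clarke_normal X x : set 'cV[R]_n :=
  closure (convex_hull (limiting_normal X x)).

Definition is_cone X := forall (t : R) x, 0 < t -> X x -> X (t *: x).

Definition polyhedral X :=
  exists (p : nat) (a : 'I_p -> 'cV[R]_n) (c : 'I_p -> R),
    X = [set x | forall i, dot (a i) x <= c i].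

End Cones.

Section Smoothness.
Context {R : realType} {n : nat}.
Implicit Types (f psi : 'cV[R]_n -> R) (x u : 'cV[R]_n).

Definition grad f x : 'cV[R]_n := \col_i 'd f x (delta_mx i 0).

Definition C1 f := (forall x, differentiable f x) /\ continuous (grad f).

Definition C11_around f x :=
  exists U : set 'cV[R]_n,
    [/\ open U, U x, forall y, U y -> differentiable f y &
        forall y, U y ->
          exists2 V, nbhs y V & [lipschitz grad f z | z in V]].

Definition graph_grad psi : set 'cV[R]_(n + n) :=
  [set col_mx x (grad psi x) | x in setT].

Definition second_subdiff psi x u : set 'cV[R]_n :=
  [set w | limiting_normal (graph_grad psi) (col_mx x (grad psi x))
             (col_mx w (- u))].

End Smoothness.

Section Problem.
Context {R : realType} {n m : nat}.
Implicit Types (f : 'cV[R]_n -> R) (phi : 'cV[R]_n -> 'cV[R]_m).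
Implicit Types (D : set 'cV[R]_m) (s : nat) (xbar : 'cV[R]_n).

Definition affine (A : 'M[R]_(m, n)) (b : 'cV[R]_m) (x : 'cV[R]_n) : 'cV[R]_m :=
  A *m x + b.

Definition feasible phi D s : set 'cV[R]_n :=
  [set x | D (phi x) /\ (l0norm x <= s)%N].

Definition local_minimizer f (Omega : set 'cV[R]_n) xbar :=
  Omega xbar /\ \forall x \near xbar, Omega x -> f xbar <= f x.

Definition RRCQ phi D xbar :=
  ([set phi xbar + 'd phi xbar v - d
     | v in [set v | v \in coord_subspace (supp xbar)] & d in D])° 0.

Definition lagrangian f phi (x : 'cV[R]_n) (lambda : 'cV[R]_m) : R :=
  f x + dot lambda (phi x).

Definition clarke_multipliers f phi D s xbar : set 'cV[R]_m :=
  [set lambda : 'cV[R]_m |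
    [/\ forall i, 0 <= lambda i 0,
        clarke_normal (sparse_set s) xbar
          (- grad (fun x => lagrangian f phi x lambda) xbar) &
        limiting_normal D (phi xbar) lambda]].

End Problem.

(* Main.v *)
Require Import Defs.
From HB Require Import structures.
From mathcomp Require Import all_boot all_order all_algebra.
From mathcomp Require Import all_classical all_reals all_analysis.
From mathcomp Require Import ring lra.
Import Order.TTheory GRing.Theory Num.Theory.
Import numFieldNormedType.Exports.
Local Open Scope classical_set_scope.
Local Open Scope ring_scope.

(** Adding the affine term [<l, A x + b>] to [f] only translates the gradient, so the
    multiplier plays no role in the second-order subdifferential.  As [D] is polyhedral,
    [xbar + t u] is feasible for all small [t > 0], hence [f (xbar + t u) >= f xbar]; since
    [<grad f xbar, u> = 0], the mean value theorem yields arbitrarily small [t > 0] at which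
    [h := <u, grad f>] satisfies [h (xbar + t u) >= h xbar].  A nonsmooth mean value inequality,
    obtained from the inf-convolution [x |-> min_w h w + K |w - x|^2], then gives points [y]
    near [xbar] and proximal subgradients [z] of [h] at [y], bounded by twice the Lipschitz
    constant, with [<z, u>] almost nonnegative.  Each [(z, -u)] is a Frechet normal to the graph
    of the gradient, and a cluster point of the [z]'s is the required vector. *)

(** * Entrywise convergence of matrices *)

Lemma cvg_mx (R : realType) (m n : nat) (T : Type) (F : set_system T) (FF : Filter F)
    (M_ : T -> 'M[R]_(m, n)) (M : 'M[R]_(m, n)) :
  (forall i j, M_ x i j @[x --> F] --> M i j) -> M_ x @[x --> F] --> M.
Proof.
move=> cM A [P PM PA]; rewrite /nbhs /=.
have : \forall x \near F, forall i, forall j, P i j (M_ x i j).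
  by apply: filter_forall => i; apply: filter_forall => j; exact: cM.
by apply: filterS => x xP; exact: PA.
Qed.

Lemma trmx_continuous (R : realType) (m n : nat) :
  continuous (@trmx R m n).
Proof.
move=> v; apply: (@cvg_mx R n m _ (nbhs v) _ trmx v^T) => i j.
by rewrite mxE; under eq_fun do rewrite mxE; exact: coord_continuous.
Qed.

(* [nbhs_pfilter] is not inferred through the filtered structure of matrices. *)
#[local] Instance mx_nbhs_pfilter (R : realType) (m n : nat) (x : 'M[R]_(m, n)) :
  ProperFilter (nbhs x).
Proof. exact: nbhs_pfilter. Qed.

(** * The Euclidean product and its comparison with the sup norm *)

Section Dot.
Context {R : realType} {n : nat}.
Implicit Types (x y z a : 'cV[R]_n).

Lemma dotC x y : dot x y = dot y x.
Proof. by apply: eq_bigr => i _; rewrite mulrC. Qed.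

Fact dot_is_linear a : linear (dot a : 'cV[R]_n -> R).
Proof.
move=> k x y; rewrite /dot scaler_sumr -big_split; apply: eq_bigr => i _ /=.
by rewrite !mxE mulrDr mulrCA.
Qed.

HB.instance Definition _ a :=
  GRing.isLinear.Build R 'cV[R]_n R *:%R (dot a) (dot_is_linear a).

Lemma dotZr a k x : dot a (k *: x) = k * dot a x.
Proof. exact: linearZ. Qed.

Lemma dotDr a x y : dot a (x + y) = dot a x + dot a y.
Proof. exact: linearD. Qed.

Lemma dotNr a x : dot a (- x) = - dot a x.
Proof. exact: linearN. Qed.

Lemma dotDl x y z : dot (x + y) z = dot x z + dot y z.
Proof. by rewrite dotC dotDr !(dotC z). Qed.

Lemma dotNl x y : dot (- x) y = - dot x y.
Proof. by rewrite dotC dotNr dotC. Qed.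

Lemma dotZl k x y : dot (k *: x) y = k * dot x y.
Proof. by rewrite dotC dotZr dotC. Qed.

Lemma cvg_dot {T : Type} {F : set_system T} {FF : Filter F}
    {x_ y_ : T -> 'cV[R]_n} {x y} :
  x_ @ F --> x -> y_ @ F --> y -> dot (x_ t) (y_ t) @[t --> F] --> dot x y.
Proof.
move=> cx cy; apply: (@cvg_big R _ +%R) => [|i _]; first exact: add_continuous.
apply: cvgM.
  exact: (continuous_cvg _ (@coord_continuous _ _ _ i 0 x)).
exact: (continuous_cvg _ (@coord_continuous _ _ _ i 0 y)).
Qed.

Lemma dot_continuous a : continuous (dot a).
Proof. by move=> x; apply: (@cvg_dot _ (nbhs x) _ (fun=> a) id a x) => //; exact: cvg_cst. Qed.

Lemma dot_ge0 x : 0 <= dot x x.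
Proof. by apply: sumr_ge0 => i _; rewrite -expr2 sqr_ge0. Qed.

Lemma coord_le_norm x i : `|x i 0| <= `|x|.
Proof.
rewrite -[leRHS]/(mx_norm x) mx_normrE.
exact: (le_bigmax _ (fun ij => `|x ij.1 ij.2|) (i, 0)).
Qed.

(** The sup norm is attained at some coordinate, whose square is one of the nonnegative summands of
    [dot x x]. *)
Lemma norm_sqr_le_dot x : `|x| ^+ 2 <= dot x x.
Proof.
have [->|x0] := eqVneq x 0; first by rewrite normr0 expr0n dot_ge0.
have [[i j] xi] : exists i, `|x| = `|x i.1 i.2|.
  by apply: (@mx_norm_neq0 R n 1 x); rewrite -[mx_norm x]/(`|x|) normr_eq0.
move: xi; rewrite /= (ord1 j) => ->.
rewrite real_normK ?num_real// /dot (bigD1 i) //= -expr2 lerDl.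
by apply: sumr_ge0 => k _; rewrite -expr2 sqr_ge0.
Qed.

Lemma normr_dot_le x y : `|dot x y| <= n%:R * `|x| * `|y|.
Proof.
apply: le_trans (ler_norm_sum _ _ _) _.
rewrite -mulrA mulr_natl -[X in _ *+ X](card_ord n) -sumr_const.
by apply: ler_sum => i _; rewrite normrM ler_pM // coord_le_norm.
Qed.

Lemma norm_leP x (r : R) : 0 <= r -> (`|x| <= r) <-> (forall i, `|x i 0| <= r).
Proof.
move=> r0; split=> [xr i|xr]; first exact: le_trans (coord_le_norm x i) xr.
rewrite -[leLHS]/(mx_norm x) mx_normrE; apply/bigmax_leP; split => // -[i j] _ /=.
by rewrite (ord1 j).
Qed.

(** A sup-norm ball is a product of segments; compactness of such products of row vectors is carried
    to columns by the continuous transposition. *)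
Lemma compact_norm_ball (c : 'cV[R]_n) (r : R) : 0 <= r ->
  compact [set x : 'cV[R]_n | `|x - c| <= r].
Proof.
move=> r0; pose S i := `[c i 0 - r, c i 0 + r]%classic.
have /continuous_compact : {within [set v : 'rV[R]_n | forall i, S i (v ord0 i)],
    continuous (@trmx R 1 n)}.
  by apply: continuous_subspaceT; exact: trmx_continuous.
move=> /(_ (rV_compact (fun i => @segment_compact _ _ _))).
congr compact; apply/seteqP; split => [_ /= [v vc <-]|x /= /(norm_leP _ _ r0) xc].
  by apply/(norm_leP _ _ r0) => i; have := vc i; rewrite /S /= !mxE in_itv /= -ler_distl.
exists x^T; last exact: trmxK.
by move=> i; have := xc i; rewrite /S /= !mxE in_itv /= -ler_distl.
Qed.

End Dot.

(** Dividing the quadratic bound by [enorm (y - x)] leaves at most [K * enorm (y - x)], which tends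
    to 0 as [y] tends to [x]. *)
Lemma proximal_frechet_normal (R : realType) (n : nat) (X : set 'cV[R]_n)
    (x v : 'cV[R]_n) (K : R) :
  (\forall y \near x, X y -> dot v (y - x) <= K * dot (y - x) (y - x)) ->
  frechet_normal X x v.
Proof.
move=> near_v; rewrite /frechet_normal /= limf_esupE; apply/lee_addgt0Pr => e e0.
rewrite add0e.
(* [K] may be zero or negative; [K1] is a positive upper bound of it, so that [e / K1] is a valid
   radius. *)
pose K1 := `|K| + 1.
have K1_gt0 : 0 < K1 by rewrite ltr_wpDl.
have d_gt0 : 0 < (e / K1) ^+ 2 by rewrite exprn_gt0 // divr_gt0.
have sq_near : \forall y \near x, dot (y - x) (y - x) < (e / K1) ^+ 2.
  have cyx : y - x @[y --> x] --> (0 : 'cV[R]_n).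
    by rewrite -[X in _ --> X](subrr x); apply: cvgB; [exact: cvg_id|exact: cvg_cst].
  have /cvgr_lt : dot (y - x) (y - x) @[y --> x] --> (0 : R).
    by rewrite -[X in _ --> X](linear0 (dot (0 : 'cV[R]_n))); exact: cvg_dot.
  exact.
apply: le_trans (ereal_inf_lbound _) _.
  (* The upper limit is an infimum of suprema over the sets of the filter; on this set the quotient
     is at most [e]. *)
  exists [set y | X y /\ y != x /\ dot v (y - x) / enorm (y - x) <= e]; last by [].
  suff : \forall y \near x, y != x -> X y ->
      X y /\ y != x /\ dot v (y - x) / enorm (y - x) <= e by [].
  near=> y => yx Xy; split => //; split => //.
  have e2 : enorm (y - x) ^+ 2 = dot (y - x) (y - x).
    by rewrite sqr_sqrtr // dot_ge0.
  have en_gt0 : 0 < enorm (y - x).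
    rewrite lt_neqAle sqrtr_ge0 andbT eq_sym -sqrf_eq0 e2.
    apply: contraNneq yx => d0; rewrite -subr_eq0 -normr_eq0 -sqrf_eq0.
    by rewrite eq_le sqr_ge0 -d0 norm_sqr_le_dot.
  rewrite ler_pdivrMr //.
  have : dot v (y - x) <= K * dot (y - x) (y - x) by move: Xy; near: y; exact: near_v.
  move=> /le_trans; apply; rewrite -e2 expr2 mulrA ler_wpM2r ?(ltW en_gt0) //.
  have en_lt : enorm (y - x) < e / K1.
    rewrite -(@ltr_pXn2r _ 2) // ?nnegrE ?(ltW en_gt0) ?divr_ge0 ?(ltW e0) ?(ltW K1_gt0) //.
    by rewrite e2; near: y.
  apply: le_trans (_ : K1 * enorm (y - x) <= _).
    by rewrite ler_wpM2r ?(ltW en_gt0) // /K1 ler_wpDr // ler_norm.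
  by rewrite mulrC -ler_pdivlMr // ltW.
by apply: ge_ereal_sup => _ [y [_ [_ ye]] <-]; rewrite lee_fin.
Unshelve. all: by end_near. Qed.

(** * Proximal subgradients as normals to the graph of a gradient *)

Section Graph.
Context {R : realType} {n : nat}.
Implicit Types (x y z u c : 'cV[R]_n) (psi : 'cV[R]_n -> R).

Lemma dot_col_mx x y z u : dot (col_mx x y) (col_mx z u) = dot x z + dot y u.
Proof.
rewrite /dot big_split_ord /=.
by congr (_ + _); apply: eq_bigr => i _; rewrite ?col_mxEu ?col_mxEd.
Qed.

Lemma usubmx_continuous : continuous (@usubmx R n n 1).
Proof.
move=> v; apply: (@cvg_mx R _ _ _ (nbhs v) _ usubmx (usubmx v)) => i j.
by rewrite mxE; under eq_fun do rewrite mxE; exact: coord_continuous.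
Qed.

Lemma cvg_col_mx (T : Type) (F : set_system T) (FF : Filter F)
    (x_ y_ : T -> 'cV[R]_n) x y : x_ @ F --> x -> y_ @ F --> y ->
  col_mx (x_ t) (y_ t) @[t --> F] --> col_mx x y.
Proof.
move=> cx cy; apply: cvg_mx => i j; case: (split_ordP i) => k ->.
  rewrite col_mxEu; under eq_fun do rewrite col_mxEu.
  exact: (continuous_cvg _ (@coord_continuous _ _ _ k j x)).
rewrite col_mxEd; under eq_fun do rewrite col_mxEd.
exact: (continuous_cvg _ (@coord_continuous _ _ _ k j y)).
Qed.

(** At a graph point over [y], pairing [(z, -u)] with the displacement gives [dot z (y - c)] minus
    the increment of [dot u (grad psi _)]. The hypothesis bounds this by [K] times the squared
    displacement of the first component; since [0 <= K], that of the gradient component can be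
    added. *)
Lemma proximal_graph_normal psi c z u (K : R) : 0 <= K ->
  (\forall y \near c,
     dot z (y - c) <= dot u (grad psi y) - dot u (grad psi c) + K * dot (y - c) (y - c)) ->
  frechet_normal (graph_grad psi) (col_mx c (grad psi c)) (col_mx z (- u)).
Proof.
move=> K0 near_z; apply: (@proximal_frechet_normal _ _ _ _ _ K).
have : \forall w \near col_mx c (grad psi c),
   dot z (usubmx w - c) <= dot u (grad psi (usubmx w)) - dot u (grad psi c)
     + K * dot (usubmx w - c) (usubmx w - c).
  have := @usubmx_continuous (col_mx c (grad psi c)).
  by rewrite /continuous_at col_mxKu => /(_ _ near_z).
apply: filterS => w + [y _ yw]; rewrite -{}yw col_mxKu -dotNr -dotDr => zy.
rewrite opp_col_mx add_col_mx !dot_col_mx dotNl mulrDr lerBlDl addrA.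
by apply: le_trans zy _; rewrite lerDl mulr_ge0 // dot_ge0.
Qed.

End Graph.

(** * Proximal points and a nonsmooth mean value inequality *)

Section ProximalMeanValue.
Context {R : realType} {n : nat}.
Implicit Types (x y z v w c p : 'cV[R]_n) (h : 'cV[R]_n -> R) (K L r e t : R).

Lemma dot_sub_sqr a v :
  dot (v - a) (v - a) = dot v v - 2 * dot a v + dot a a :> R.
Proof. by rewrite !(dotDl, dotDr, dotNl, dotNr) (dotC v a); ring. Qed.

Lemma proximal_point_exists h c x r K : 0 <= r -> continuous h ->
  exists2 y, `|y - c| <= r & forall w, `|w - c| <= r ->
    h y + K * dot (y - x) (y - x) <= h w + K * dot (w - x) (w - x).
Proof.
move=> r0 ch.
have [|y|y /set_mem yr ymin] := compact_EVT_min (f := fun w => h w + K * dot (w - x) (w - x))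
    _ (compact_norm_ball c _ r0).
- by exists c; rewrite /= subrr normr0.
- apply: continuous_subspaceT => {}y; apply: cvgD; first exact: ch.
  apply: cvgM; first exact: cvg_cst.
  have cy : w - x @[w --> y] --> y - x by apply: cvgB; [exact: cvg_id|exact: cvg_cst].
  exact: cvg_dot.
- by exists y => // w wr; apply: ymin; exact/mem_set.
Qed.

(** Comparing [y] with the competitor [x] gives [K * |y - x|^2 <= h x - h y <= L * |y - x|]; then
    one factor [|y - x|] cancels. *)
Lemma proximal_point_near h c x y r K L : 0 < K -> 0 <= L ->
    (forall x y, `|x - c| <= r -> `|y - c| <= r -> `|h x - h y| <= L * `|x - y|) ->
    `|x - c| <= r -> `|y - c| <= r ->
    h y + K * dot (y - x) (y - x) <= h x ->
  K * `|y - x| <= L.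
Proof.
move=> K0 L0 hL xr yr hyx.
have : K * `|y - x| ^+ 2 <= L * `|y - x|.
  apply: le_trans (ler_wpM2l (ltW K0) (norm_sqr_le_dot (y - x))) _.
  apply: le_trans (hL _ _ yr xr); rewrite distrC; apply: le_trans (ler_norm _).
  by rewrite lerBrDl.
have [->|yx0] := eqVneq (`|y - x|) 0.
  by move=> _; rewrite mulr0.
by rewrite expr2 mulrA ler_pM2r // lt_neqAle eq_sym yx0 normr_ge0.
Qed.

(** As [y] is interior to the ball, all nearby [w] are competitors. Expanding the square of
    [w - x = (w - y) - (x - y)] turns minimality into the proximal inequality, with
    [2 * K * (x - y)] as subgradient. *)
Lemma proximal_point_subgradient h c x y r K : `|y - c| < r ->
    (forall w, `|w - c| <= r ->
      h y + K * dot (y - x) (y - x) <= h w + K * dot (w - x) (w - x)) ->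
  \forall w \near y, dot ((2 * K) *: (x - y)) (w - y) <=
    h w - h y + K * dot (w - y) (w - y).
Proof.
move=> yr ymin.
have cy : w - c @[w --> y] --> y - c by apply: cvgB; [exact: cvg_id|exact: cvg_cst].
have /cvgr_lt /(_ _ yr) : `|w - c| @[w --> y] --> `|y - c| by exact: cvg_norm.
apply: filterS => w /ltW /ymin.
have -> : w - x = (w - y) - (x - y) by rewrite opprB addrA subrK.
rewrite -(opprB x y) dot_sub_sqr dotZl dotNl dotNr opprK.
move: (dot (x - y) (x - y)) (dot (w - y) (w - y)) (dot (x - y) (w - y)) => p q s.
lra.
Qed.

(* The value function [min_w h w + K |w - x|^2] is compared along a fine subdivision of the
   segment: one step [x -> x + N^-1 v] raises it by at most
   [N^-1 dot z v + K N^-2 dot v v], where [z] is the proximal subgradient attached to [x]. *)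
Lemma proximal_mean_value h c p v r L e : 0 < r -> 0 <= L -> 0 < e -> continuous h ->
    (forall x y, `|x - c| <= r -> `|y - c| <= r -> `|h x - h y| <= L * `|x - y|) ->
    (forall t, 0 <= t <= 1 -> `|p + t *: v - c| <= r / 2) ->
    h p <= h (p + v) ->
  exists y z K, [/\ 0 <= K, `|y - c| < r, `|z| <= 2 * L, - e <= dot z v &
    \forall w \near y, dot z (w - y) <= h w - h y + K * dot (w - y) (w - y)].
Proof.
move=> r0 L0 e0 ch hL pv hpv.
(* The bound [2 * L < K * r] puts the proximal point of [x] within [r / 2] of [x], hence inside the
   open ball; [L ^+ 2 <= K * e] keeps the value function within [e / 4] below [h]. *)
have [K [K0 Kr Ke]] : exists K, [/\ 0 < K, 2 * L < K * r & L ^+ 2 <= K * e].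
  have Lr0 : 0 <= L / r by rewrite divr_ge0 // ltW.
  have Le0 : 0 <= L ^+ 2 / e by rewrite divr_ge0 ?sqr_ge0 // ltW.
  exists (4 * (L / r) + L ^+ 2 / e + 1); split; first lra.
    have -> : (4 * (L / r) + L ^+ 2 / e + 1) * r = 4 * L + L ^+ 2 / e * r + r.
      by field; rewrite !gt_eqF.
    by have := mulr_ge0 Le0 (ltW r0); lra.
  have -> : (4 * (L / r) + L ^+ 2 / e + 1) * e = 4 * (L / r * e) + L ^+ 2 + e.
    by field; rewrite !gt_eqF.
  by have := mulr_ge0 Lr0 (ltW e0); lra.
have r2 : r / 2 <= r by lra.
have /choice [Y YP] : forall x, exists y, `|x - c| <= r / 2 ->
    `|y - c| <= r /\ forall w, `|w - c| <= r ->
    h y + K * dot (y - x) (y - x) <= h w + K * dot (w - x) (w - x).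
  move=> x; have [y yr ymin] := proximal_point_exists h c x r K (ltW r0) ch.
  by exists y.
have Ynear x : `|x - c| <= r / 2 -> K * `|Y x - x| <= L.
  move=> xr; have [yr ymin] := YP x xr; have xr' := le_trans xr r2.
  apply: (proximal_point_near h c x (Y x) r) => //.
  by have := ymin x xr'; rewrite subrr linear0 mulr0 addr0.
have Yint x : `|x - c| <= r / 2 -> `|Y x - c| < r.
  move=> xr; have Kyx := Ynear x xr.
  have yx : `|Y x - x| < r / 2.
    by rewrite -(ltr_pM2l K0); apply: le_lt_trans Kyx _; lra.
  have -> : Y x - c = (Y x - x) + (x - c) by rewrite addrA subrK.
  by apply: le_lt_trans (ler_normD _ _) _; lra.
pose Z x := (2 * K) *: (x - Y x).
(* If no such subgradient exists, every [Z x] satisfies [dot (Z x) v < - e], so the value function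
   [M] must drop along the segment by more than [h p <= h (p + v)] permits. *)
apply: contrapT => noz.
have Zlt x : `|x - c| <= r / 2 -> dot (Z x) v < - e.
  move=> xr; rewrite ltNge; apply/negP => zv; apply: noz.
  exists (Y x), (Z x), K; split=> //; [exact: ltW|exact: Yint| |].
    rewrite normrZ ger0_norm ?mulr_ge0 ?(ltW K0) // distrC.
    by have := Ynear x xr; lra.
  apply: (proximal_point_subgradient h c _ _ r); first exact: Yint.
  by have [] := YP x xr.
pose M x := h (Y x) + K * dot (Y x - x) (Y x - x).
have Mstep x t : 0 < t -> `|x - c| <= r / 2 -> `|x + t *: v - c| <= r / 2 ->
    M (x + t *: v) <= M x - t * e + K * t ^+ 2 * dot v v.
  (* The minimizer [Y x] belonging to [x] serves as competitor at [x + t *: v]. *)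
  move=> t0 xr xtr; have [_ ymin] := YP _ xtr.
  apply: le_trans (ymin (Y x) (ltW (Yint x xr))) _.
  have := Zlt x xr; rewrite -(ltr_pM2l t0) /M /Z -(opprB x (Y x)).
  have -> : Y x - (x + t *: v) = - (x - Y x) - t *: v by rewrite opprB opprD addrA.
  rewrite (dot_sub_sqr (t *: v)) !(dotNl, dotNr, dotZl, dotZr) !opprK (dotC v).
  move: (dot (x - Y x) (x - Y x)) (dot (x - Y x) v) (dot v v) => a b d.
  lra.
have vv0 := dot_ge0 v.
(* The quadratic errors of [N] steps of length [1 / N] add up to [K * dot v v / N]. Once this is at
   most [e / 4], [M] drops by at least [3 * e / 4] over the whole segment. *)
have [N N0 NK] : exists2 N : nat, 0 < N%:R :> R & K * dot v v / N%:R <= e / 4.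
  exists (Num.bound (4 * K * dot v v / e)).+1; first by rewrite ltr0n.
  rewrite ler_pdivrMr ?ltr0n //.
  have : 4 * K * dot v v / e < (Num.bound (4 * K * dot v v / e)).+1%:R.
    apply: lt_trans (archi_boundP _) _; last by rewrite ltr_nat.
    by rewrite divr_ge0 ?mulr_ge0 ?(ltW e0) // (ltW K0).
  by rewrite ltr_pdivrMr //; lra.
have segm (i : nat) : (i <= N)%N -> `|p + (i%:R / N%:R) *: v - c| <= r / 2.
  move=> iN; apply: pv; rewrite divr_ge0 ?(ltW N0) ?ler0n //=.
  by rewrite ler_pdivrMr // mul1r ler_nat.
have Mind (i : nat) : (i <= N)%N -> M (p + (i%:R / N%:R) *: v) <=
    M p - i%:R / N%:R * (e - K * dot v v / N%:R).
  elim: i => [_|i IH iN]; first by rewrite !mul0r scale0r subr0 addr0.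
  have xi : p + (i.+1%:R / N%:R) *: v = p + (i%:R / N%:R) *: v + N%:R^-1 *: v.
    by rewrite -addrA -scalerDl -natr1 mulrDl mul1r.
  have iN' := ltnW iN.
  have := Mstep (p + (i%:R / N%:R) *: v) N%:R^-1; rewrite -xi invr_gt0.
  move=> /(_ N0 (segm _ iN') (segm _ iN)) /le_trans; apply.
  have := IH iN'; rewrite -natr1.
  move: (M _) (M p) (dot v v) => a b d.
  lra.
have := Mind N (leqnn N); rewrite divff ?gt_eqF // scale1r mul1r => MN.
have := segm N (leqnn N); rewrite divff ?gt_eqF // scale1r => pvr.
have := segm 0%N isT; rewrite mul0r scale0r addr0 => pr.
have Mp : M p <= h p.
  have [_ /(_ p (le_trans pr r2))] := YP p pr.
  by rewrite subrr linear0 mulr0 addr0.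
have Mpv : h (p + v) - e / 4 <= M (p + v).
  have [yr _] := YP _ pvr.
  have := hL _ _ yr (le_trans pvr r2); rewrite ler_norml => /andP[hY _].
  have sq := norm_sqr_le_dot (Y (p + v) - (p + v)); rewrite -(ler_pM2l K0) in sq.
  (* With [q] the distance from [p + v] to its proximal point, [(2 * K * q - L)^2 >= 0] gives [K *
     q^2 - L * q >= - L^2 / (4 * K) >= - e / 4]. *)
  have := sqr_ge0 (2 * K * `|Y (p + v) - (p + v)| - L) => pos.
  have : - (e / 4) <= K * `|Y (p + v) - (p + v)| ^+ 2 - L * `|Y (p + v) - (p + v)|.
    by rewrite -(ler_pM2l K0); lra.
  by rewrite /M; lra.
by lra.
Qed.

End ProximalMeanValue.

(** * Limits of graph normals and the second-order subdifferential *)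

Section SecondSubdiff.
Context {R : realType} {n : nat}.
Implicit Types (x y z u : 'cV[R]_n) (psi : 'cV[R]_n -> R).

Lemma cvg_natSinv (a_ : nat -> 'cV[R]_n) a :
  (forall k, `|a_ k - a| <= k.+1%:R^-1) -> a_ @ \oo --> a.
Proof.
move=> a_a; apply/cvgrPdist_lt => e e0.
have := near_infty_natSinv_lt (PosNum e0); apply: filterS => k /=.
by apply: le_lt_trans; rewrite distrC.
Qed.

(** Each neighborhood of a cluster point meets each tail of the sequence. The indices [J k] need not
    increase strictly: [k <= J k] suffices for passing to the limit. *)
Lemma cluster_subseq (a_ : nat -> 'cV[R]_n) a : cluster (a_ @ \oo) a ->
  exists J : nat -> nat, forall k, (k <= J k)%N /\ `|a_ (J k) - a| <= k.+1%:R^-1.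
Proof.
move=> cla; suff /choice [J JP] : forall k : nat, exists j : nat,
  (k <= j)%N /\ `|a_ j - a| <= k.+1%:R^-1 by exists J.
move=> k.
have near_a : nbhs a [set b | `|b - a| <= k.+1%:R^-1].
  apply: nbhs_le_nbhs_norm; exists k.+1%:R^-1; first by rewrite /= invr_gt0 ltr0n.
  by move=> b /=; rewrite distrC => /ltW.
have tail : (a_ @ \oo) (a_ @` [set j | (k <= j)%N]).
  by exists k => // j kj; exists j.
by have [_ [[j kj <-] aj]] := cla _ _ tail near_a; exists j.
Qed.

Lemma C11_around_lipschitz psi x : C11_around psi x ->
  exists V M, [/\ nbhs x V, 0 <= M & forall y w, V y -> V w ->
    `|grad psi y - grad psi w| <= M * `|y - w|].
Proof.
move=> [U [_ Ux _ /(_ x Ux) [V Vx [M0 [_ lipV]]]]].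
(* The Lipschitz bound is available for every constant strictly above [M0], whose sign is
   unknown. *)
exists V, (Num.max M0 0 + 1); split=> //.
  by rewrite addr_ge0 // le_max lexx orbT.
move=> y w Vy Vw; apply: (lipV _ _ (y, w)) => //.
by rewrite ltr_pwDr // le_max lexx.
Qed.

Lemma second_subdiff_ge0 psi x u : continuous (grad psi) ->
    (exists V M, [/\ nbhs x V, 0 <= M & forall y w, V y -> V w ->
       `|grad psi y - grad psi w| <= M * `|y - w|]) ->
    (forall d : R, 0 < d -> exists2 t : R, 0 < t < d &
       dot u (grad psi x) <= dot u (grad psi (x + t *: u))) ->
  exists2 z, second_subdiff psi x u z & 0 <= dot z u.
Proof.
move=> cpsi [V [M [/nbhs_norm_le_nbhs [r /= r0 rV] M0 lipM]]] incr.
pose h y := dot u (grad psi y).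
have ch : continuous h.
  move=> y; apply: (continuous_comp (cpsi y)); exact: dot_continuous.
have [L L0 hL] : exists2 L : R, 0 <= L & forall y w, `|y - x| < r -> `|w - x| < r ->
    `|h y - h w| <= L * `|y - w|.
  exists (n%:R * `|u| * M); first by rewrite !mulr_ge0.
  move=> y w yr wr; rewrite /h -dotNr -dotDr.
  apply: le_trans (normr_dot_le _ _) _; rewrite -[leRHS]mulrA.
  apply: ler_wpM2l; first by rewrite mulr_ge0.
  by apply: lipM; apply: rV => /=; rewrite distrC.
have step (d : R) : 0 < d -> exists yz : 'cV[R]_n * 'cV[R]_n,
    [/\ `|yz.1 - x| <= d, `|yz.2| <= 2 * L, - d <= dot yz.2 u &
      frechet_normal (graph_grad psi) (col_mx yz.1 (grad psi yz.1)) (col_mx yz.2 (- u))].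
  (* A ball of radius [q] gives both the required closeness [d] and validity of the Lipschitz
     estimate. *)
  move=> d0; have [q [q0 qd qr]] : exists q, [/\ 0 < q, q <= d & q < r].
    exists (Num.min d (r / 2)); rewrite lt_min d0 divr_gt0 // ge_min lexx; split => //.
    by rewrite gt_min; apply/orP; right; lra.
  (* For [t] below [q / (2 * (|u| + 1))] the segment from [x] to [x + t *: u] stays within [q / 2]
     of [x]; the added 1 covers [u = 0]. *)
  have u1 : 0 < 2 * (`|u| + 1) by rewrite mulr_gt0 // ltr_wpDl.
  have [t /andP[t0 tq] htu] := incr (q / (2 * (`|u| + 1))) (divr_gt0 q0 u1).
  rewrite ltr_pdivlMr // in tq.
  (* The direction is [t *: u], so the tolerance [t * d] becomes [d] after division by [t]. *)
  have [] := @proximal_mean_value R n h x x (t *: u) q L (t * d) q0 L0 _ ch.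
  - by rewrite mulr_gt0.
  - by move=> y w yq wq; apply: hL; [exact: le_lt_trans yq qr|exact: le_lt_trans wq qr].
  - move=> k /andP[k0 k1]; rewrite addrAC subrr add0r !normrZ !ger0_norm // ?(ltW t0) //.
    apply: le_trans (_ : t * `|u| <= _).
      by rewrite ler_piMl // mulr_ge0 // ltW.
    rewrite ler_pdivlMr //; apply: le_trans (ltW tq); rewrite -mulrA ler_wpM2l ?(ltW t0) //.
    by rewrite mulrC ler_wpM2l // ler_wpDr.
  - exact: htu.
  move=> y [z [K [K0 yq zL zv near_z]]]; exists (y, z); split => //=.
  - exact: ltW (lt_le_trans yq qd).
  - by rewrite -(ler_pM2l t0) mulrN -dotZr.
  - exact: (@proximal_graph_normal _ _ psi y z u K).
have /choice [YZ YZP] : forall k : nat, exists yz : 'cV[R]_n * 'cV[R]_n,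
    [/\ `|yz.1 - x| <= k.+1%:R^-1, `|yz.2| <= 2 * L, - k.+1%:R^-1 <= dot yz.2 u &
      frechet_normal (graph_grad psi) (col_mx yz.1 (grad psi yz.1)) (col_mx yz.2 (- u))].
  by move=> k; apply: step; rewrite invr_gt0 ltr0n.
have [z [_ /cluster_subseq [J JP]]] : [set z | `|z - 0| <= 2 * L] `&`
    cluster ((fun k => (YZ k).2) @ \oo) !=set0.
  apply: (compact_norm_ball 0 (2 * L)); first by rewrite mulr_ge0.
  by exists 0%N => // k _ /=; rewrite subr0; have [] := YZP k.
have JS k : (J k).+1%:R^-1 <= k.+1%:R^-1 :> R.
  by rewrite lef_pV2 ?posrE ?ltr0n // ler_nat ltnS; have [] := JP k.
have cY : (YZ (J k)).1 @[k --> \oo] --> x.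
  by apply: cvg_natSinv => k; apply: le_trans (JS k); have [] := YZP (J k).
have cZ : (YZ (J k)).2 @[k --> \oo] --> z.
  by apply: cvg_natSinv => k; have [] := JP k.
exists z.
  exists (fun k => col_mx (YZ (J k)).1 (grad psi (YZ (J k)).1)),
    (fun k => col_mx (YZ (J k)).2 (- u)); split.
  - by move=> k; exists (YZ (J k)).1.
  - by apply: cvg_col_mx => //; exact: (continuous_cvg _ (cpsi x) cY).
  - by move=> k; have [] := YZP (J k).
  - by apply: cvg_col_mx => //; exact: cvg_cst.
have cd : dot (YZ (J k)).2 u @[k --> \oo] --> dot z u.
  by apply: cvg_dot => //; exact: cvg_cst.
have ch0 : - (k.+1%:R^-1 : R) @[k --> \oo] --> (0 : R).
  by rewrite -[X in _ --> X]oppr0; apply: cvgN; exact: cvg_harmonic.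
apply: (ler_cvg_to ch0 cd); apply: nearW => k.
have [_ _ + _] := YZP (J k); apply: le_trans.
by rewrite lerN2.
Qed.

End SecondSubdiff.

(** * Gradients and derivatives along lines *)

Section Gradients.
Context {R : realType} {n : nat}.
Implicit Types (x y u : 'cV[R]_n) (f : 'cV[R]_n -> R).

Lemma diff_dot_grad f x u : 'd f x u = dot (grad f x) u.
Proof.
rewrite [u in LHS]matrix_sum_delta linear_sum; apply: eq_bigr => i _.
by rewrite big_ord1 linearZ /= mxE mulrC.
Qed.

Lemma dot_delta x i : dot x (delta_mx i 0) = x i 0.
Proof.
rewrite /dot (bigD1 i) //= mxE !eqxx mulr1 big1 ?addr0 // => j ji.
by rewrite mxE (negPf ji) mulr0.
Qed.

Lemma dot_mulmx m (A : 'M[R]_(m, n)) l x : dot l (A *m x) = dot (A^T *m l) x.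
Proof.
have dotE k (a c : 'cV[R]_k) : dot a c = (a^T *m c) 0 0.
  by rewrite mxE; apply: eq_bigr => i _; rewrite mxE.
by rewrite !dotE trmx_mul trmxK mulmxA.
Qed.

Lemma grad_lagrangian_affine m f (A : 'M[R]_(m, n)) b l x : differentiable f x ->
  grad (fun y => lagrangian f (affine A b) y l) x = grad f x + A^T *m l.
Proof.
move=> df.
have -> : (fun y => lagrangian f (affine A b) y l) = f + (dot (A^T *m l) + cst (dot l b)).
  by apply/funext => y; rewrite /lagrangian /affine dotDr dot_mulmx.
have da : is_diff x (dot (A^T *m l)) (dot (A^T *m l)).
  apply: DiffDef; first by apply: linear_differentiable; exact: dot_continuous.
  by apply: diff_lin; exact: dot_continuous.
have [_ dval] := is_diffD (differentiableP df) (is_diffD da (is_diff_cst (dot l b) x)).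
apply/colP => i; rewrite [LHS]mxE [RHS]mxE [grad f x i 0]mxE [X in X _ = _]dval.
by rewrite -(dot_delta (A^T *m l)) -[RHS]addr0 -addrA.
Qed.

Lemma is_derive_line f x u (t : R) : (forall y, differentiable f y) ->
  is_derive t 1 (fun s : R => f (x + s *: u)) (dot u (grad f (x + t *: u))).
Proof.
move=> df.
have dl : is_diff t (fun s : R => x + s *: u) ( *:%R^~ u : R -> 'cV[R]_n).
  have := is_diffD (is_diff_cst x t) (is_diff_scalel t u).
  by rewrite add0r.
have := is_diff_comp dl (differentiableP (df (x + t *: u))).
case=> dfc dval; apply: DeriveDef; first exact: diff_derivable.
transitivity ('d (f \o (fun s : R => x + s *: u)) t (1 : R)).
  by apply: deriveE.
by rewrite dval /= scale1r diff_dot_grad dotC.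
Qed.

(** Choose [e < d] with [f x <= f (x + e *: u)]. The mean value theorem on [[0, e]] yields a [t]
    where the directional derivative is nonnegative, while at [x] it is zero. *)
Lemma grad_increase_along f x u : (forall y, differentiable f y) ->
    dot (grad f x) u = 0 ->
    (\forall t \near 0^'+, f x <= f (x + t *: u)) ->
  forall d : R, 0 < d -> exists2 t : R, 0 < t < d &
    dot u (grad f x) <= dot u (grad f (x + t *: u)).
Proof.
move=> df u0 fx d d0.
have [e [e0 ed fe]] : exists e : R, [/\ 0 < e, e < d & f x <= f (x + e *: u)].
  near (0 : R)^'+ => e; exists e; split; near: e => //.
    exact: nbhs_right_gt.
  exact: nbhs_right_lt.
have df' (s : R) : is_derive s 1 (fun s : R => f (x + s *: u)) (dot u (grad f (x + s *: u))).
  exact: is_derive_line.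
have [|t] := MVT (f := fun s : R => f (x + s *: u))
    (df := fun s => dot u (grad f (x + s *: u))) e0 (fun s _ => df' s).
  apply: continuous_subspaceT => s; apply: differentiable_continuous.
  by apply/derivable1_diffP; case: (df' s).
rewrite in_itv /= => /andP[t0 te]; rewrite scale0r addr0 subr0 => fxe.
exists t; first by rewrite t0 (lt_trans te).
have /le_trans : dot u (grad f x) <= 0 by rewrite dotC u0.
apply; rewrite -(pmulr_lge0 _ e0); move: fxe => /= <-; rewrite subr_ge0.
exact: fe.
Unshelve. all: by end_near. Qed.

End Gradients.

(** * Tangent directions are feasible directions *)

Section Feasible.
Context {R : realType} {n m : nat}.
Implicit Types (x u : 'cV[R]_n) (A : 'M[R]_(m, n)).

(** Sparsity is preserved because [x + t *: u] is supported in the union of the supports of [x] and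
    [u], which is contained in the support of a feasible point. The finitely many linear constraints
    are treated one by one. *)
Lemma feasible_direction A b (D : set 'cV[R]_m) s x u : polyhedral D ->
    feasible (affine A b) D s x ->
    contingent_cone (feasible (affine A b) D s) x u ->
  \forall t \near (0 : R)^'+, feasible (affine A b) D s (x + t *: u).
Proof.
move=> [p [a [c ->]]] [/= xD xs] [t_ [u_ [t0 ct cu xk]]].
have affD t v : affine A b (x + t *: v) = affine A b x + t *: (A *m v).
  by rewrite /affine mulmxDr -scalemxAr addrAC.
have sparse t : (l0norm (x + t *: u) <= s)%N.
  (* For large [k] no coordinate in the union vanishes: on [supp x] the limit is [x i 0], and
     elsewhere the coordinate is [t_ k * u_ k i 0] with [u_ k i 0] tending to a nonzero value. *)
  have [k xuk] : exists k, supp x :|: supp u \subset supp (x + t_ k *: u_ k).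
    have : \forall k \near \oo, forall i, i \in supp x :|: supp u ->
        i \in supp (x + t_ k *: u_ k).
      apply: filter_forall => i.
      have cui : u_ k i 0 @[k --> \oo] --> u i 0.
        exact: (continuous_cvg _ (@coord_continuous _ _ _ i 0 u) cu).
      case: (eqVneq (x i 0) 0) => xi.
        case: (eqVneq (u i 0) 0) => ui.
          by apply: nearW => k; rewrite !inE xi ui eqxx.
        have : \forall k \near \oo, u_ k i 0 != 0 by exact: cvgr_neq0 cui ui.
        apply: filterS => k uk _.
        by rewrite inE !mxE xi add0r mulf_neq0 // gt_eqF.
      have cxi : x i 0 + t_ k * u_ k i 0 @[k --> \oo] --> x i 0.
        rewrite -[X in _ --> X]addr0 -(mul0r (u i 0)).
        by apply: cvgD; [exact: cvg_cst|exact: cvgM].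
      have : \forall k \near \oo, x i 0 + t_ k * u_ k i 0 != 0 by exact: cvgr_neq0 cxi xi.
      by apply: filterS => k + _; rewrite inE !mxE.
    move=> /filter_ex [k xuk]; exists k; apply/fintype.subsetP => i; exact: xuk.
  have [_] := xk k; apply: leq_trans; apply: subset_leq_card.
  apply: fintype.subset_trans xuk; apply/fintype.subsetP => i; rewrite !inE !mxE.
  by apply: contraR; rewrite negb_or !negbK => /andP[/eqP-> /eqP->]; rewrite mulr0 addr0.
suff : \forall t \near (0 : R)^'+, forall i, dot (a i) (affine A b (x + t *: u)) <= c i.
  by apply: filterS => t tD; split.
(* An active constraint has nonpositive slope along each [u_ k], hence along [u]; an inactive one
   remains strict for small [t] by continuity. *)
apply: filter_forall => i; have := xD i; rewrite le_eqVlt => /predU1P[xi|xi].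
  have au : dot (a i) (A *m u) <= 0.
    have cau : dot (A^T *m a i) (u_ k) @[k --> \oo] --> dot (A^T *m a i) u.
      by apply: cvg_dot => //; exact: cvg_cst.
    rewrite dot_mulmx; apply: (ler_cvg_to cau (cvg_cst 0)); apply: nearW => k.
    have [/(_ i)] := xk k; rewrite affD dotDr xi dotZr gerDl -dot_mulmx.
    by rewrite pmulr_rle0.
  near=> t; have t_gt0 : 0 < t by near: t; exact: nbhs_right_gt.
  by rewrite affD dotDr xi dotZr gerDl pmulr_rle0.
have /cvgr_lt /(_ _ xi) : dot (a i) (affine A b x) + t * dot (a i) (A *m u) @[t --> (0 : R)^'+] -->
    dot (a i) (affine A b x).
  rewrite -[X in _ --> X]addr0 -[X in _ --> _ + X](mul0r (dot (a i) (A *m u))).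
  apply: cvgD; first exact: cvg_cst.
  apply: cvgM; last exact: cvg_cst.
  by apply: cvg_at_right_filter; exact: cvg_id.
apply: filterS => t /ltW.
by rewrite affD dotDr dotZr.
Unshelve. all: by end_near. Qed.

End Feasible.

(** * The second-order necessary condition *)

Theorem theorem3p2 (R : realType) (n m s : nat)
  (hn : (1 <= n)%N) (hm : (1 <= m)%N) (hs : (0 < s < n)%N)
  (f : 'cV[R]_n -> R) (hf : C1 f)
  (A : 'M[R]_(m, n)) (b : 'cV[R]_m) (D : set 'cV[R]_m)
  (hDclosed : closed D) (hDconvex : @convex_set R 'cV[R]_m D)
  (hDcone : is_cone D) (hDpoly : polyhedral D)
  (xbar : 'cV[R]_n) (hx0 : xbar != 0)
  (hmin : local_minimizer f (feasible (affine A b) D s) xbar)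
  (hf11 : C11_around f xbar)
  (hRRCQ : RRCQ (affine A b) D xbar) :
  forall u : 'cV[R]_n,
    contingent_cone (feasible (affine A b) D s) xbar u ->
    dot (grad f xbar) u = 0 ->
  forall lambda : 'cV[R]_m,
    clarke_multipliers f (affine A b) D s xbar lambda ->
  exists2 z : 'cV[R]_n,
    second_subdiff (fun x => lagrangian f (affine A b) x lambda) xbar u z &
    0 <= dot z u.
Proof.
move=> u Tu gu0 l _; have [df cf] := hf; have [xO xmin] := hmin.
set psi := fun x => lagrangian f (affine A b) x l.
have gpsi : grad psi = fun y => grad f y + A^T *m l.
  by apply/funext => y; exact: grad_lagrangian_affine.
clearbody psi.
have cpsi : continuous (grad psi).
  by rewrite gpsi => y; apply: cvgD; [exact: cf|exact: cvg_cst].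
have [V [M [Vx M0 lipM]]] := C11_around_lipschitz _ _ hf11.
have lip y w : V y -> V w -> `|grad psi y - grad psi w| <= M * `|y - w|.
  (* Rewriting directly would make unification unfold [grad f y] against [grad f w]. *)
  have shift (a c d : 'cV[R]_n) : (a + d) - (c + d) = a - c.
    by rewrite opprD addrACA subrr addr0.
  by rewrite gpsi shift; exact: lipM.
apply: second_subdiff_ge0 => [//||d d0]; first by exists V, M; split.
have [t td incr] : exists2 t : R, 0 < t < d &
    dot u (grad f xbar) <= dot u (grad f (xbar + t *: u)).
  apply: grad_increase_along => //.
  have line : xbar + t *: u @[t --> (0 : R)^'+] --> xbar.
    rewrite -[X in _ --> X]addr0 -(scale0r u); apply: cvgD; first exact: cvg_cst.
    by apply: cvgZl; apply: cvg_at_right_filter; exact: cvg_id.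
  have near_min := line _ xmin.
  near=> t; have fe : feasible (affine A b) D s (xbar + t *: u).
    by near: t; exact: (feasible_direction _ _ _ _ _ _ hDpoly xO Tu).
  by move: fe; near: t; exact: near_min.
have mono (a c e : 'cV[R]_n) : dot u a <= dot u c -> dot u (a + e) <= dot u (c + e).
  by rewrite !dotDr lerD2r.
by exists t; rewrite ?gpsi; [exact: td|exact: mono].
Unshelve. all: by end_near. Qed.
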